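(* Let $\mathcal{V}\subset\mathbb{V}=\mathbb{R}^n$ be a (finite) training set and let $\mathcal{R}_\infty$ denote a ResNet trained to convergence under squared loss in the infinite-width limit, with prior $\mathcal{GP}(\mu,K)$ at initialization and neural tangent kernel $\Theta$. If the test point $v^*\in\mathbb{V}$ is such that the kernel correlation satisfies $$\lim_{\|v^*-\mathcal{V}\|\to\infty}\|\Theta(v^*,\mathcal{V})\|_2 = 0,$$ then the predictive distribution at $v^*$ converges to the initial prior in distribution, $\mathcal{R}_\infty(v^* )\to\mathcal{GP}(\mu,K)$; that is, as $\|v^*-\mathcal{V}\|\to\infty$, the Lévy–Prokhorov distance between the law of $\mathcal{R}_\infty(v^* )$ and the prior law $\mathcal{N}(\mu(v^* ),K(v^*,v^* ))$ tends to $0$.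
   Context: Outputs lie in $\mathbb{W}=\mathbb{R}^d$; kernels are real-valued and act identically and independently on each output coordinate. $\|v^*-\mathcal{V}\|$ is the distance from $v^*$ to the set $\mathcal{V}$. $\Theta(v^*,\mathcal{V})$ is the row vector $(\Theta(v^*,v_i))_{v_i\in\mathcal{V}}$ and $\Theta(\mathcal{V},\mathcal{V})$ the corresponding Gram matrix. ResNet: $\mathcal{R}=\mu+\mathcal{R}_{\mathrm{res}}$, with $\mu:\mathbb{V}\to\mathbb{W}$ a deterministic measurable map and $\mathcal{R}_{\mathrm{res}}$ a neural network under NTK parameterization (i.i.d. standard Gaussian weights and biases, each layer's weights scaled by the inverse square root of the width). In the infinite-width limit: (a) at initialization $\mathcal{R}_0$ is a Gaussian process with mean function $\mu$ and covariance function $K$, the NNGP kernel of $\mathcal{R}_{\mathrm{res}}$; (b) the neural tangent kernel $\Theta(v,v')=\nabla_\theta\mathcal{R}(v)^\top\nabla_\theta\mathcal{R}(v')$ is a deterministic symmetric positive semidefinite kernel on $\mathbb{V}$, constant during training; (c) under gradient flow on the squared loss with learning rate $\eta>0$ and a fixed finite vector $Y$ of targets on $\mathcal{V}$, the network evolves for every $v\in\mathbb{V}$ by $$\frac{d}{dt}\mathcal{R}_t(v) = -\eta\,\Theta(v,\mathcal{V})\,\bigl(\mathcal{R}_t(\mathcal{V})-Y\bigr),$$ with initial condition $\mathcal{R}_0$. The network trained to convergence is $\mathcal{R}_\infty(v)=\lim_{t\to\infty}\mathcal{R}_t(v)$. The standing assumption is that the training Gram matrix $\Theta(\mathcal{V},\mathcal{V})$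 is positive definite. *)

(* Defs.v *)
From HB Require Import structures.
From mathcomp Require Import all_boot all_order all_algebra.
From mathcomp Require Import all_classical all_reals all_analysis.
From mathcomp Require Import measurable_realfun.

Set Implicit Arguments.
Unset Strict Implicit.
Unset Printing Implicit Defensive.

Import Order.TTheory GRing.Theory Num.Theory.
Import numFieldTopology.Exports numFieldNormedType.Exports.

Local Open Scope classical_set_scope.
Local Open Scope ring_scope.

(* The library norm on matrices is the sup norm; distances below are Euclidean. *)
Definition l2norm (R : realType) (k : nat) (u : 'rV[R]_k) : R :=
  Num.sqrt (\sum_i u 0 i ^+ 2).

(* Extended-real valued, so that the distance to the empty set is +oo. *)
Definition dist_set (R : realType) (n : nat) (v : 'rV[R]_n)
    (S : set 'rV[R]_n) : \bar R :=
  ereal_inf [set (l2norm (v - x))%:E | x in S].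

(* The filter "dist_set v S tends to infinity". *)
Definition far_from (R : realType) (n : nat) (S : set 'rV[R]_n) :
    set_system 'rV[R]_n :=
  filter_from [set: R] (fun M => [set v | (M%:E < dist_set v S)%E]).

Definition psdmx (R : realType) (k : nat) (A : 'M[R]_k) : Prop :=
  A^T = A /\ forall u : 'rV[R]_k, 0 <= (u *m A *m u^T) 0 0.

Definition pdmx (R : realType) (k : nat) (A : 'M[R]_k) : Prop :=
  A^T = A /\ forall u : 'rV[R]_k, u != 0 -> 0 < (u *m A *m u^T) 0 0.

Definition gram (R : realType) (T : Type) (k : nat) (C : T -> T -> R)
    (x : 'I_k -> T) : 'M[R]_k :=
  \matrix_(i, j) C (x i) (x j).

Definition psd_kernel (R : realType) (T : Type) (C : T -> T -> R) : Prop :=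
  forall k (x : 'I_k -> T), psdmx (gram C x).

Definition kernel_row (R : realType) (T : Type) (k : nat) (C : T -> T -> R)
    (v : T) (x : 'I_k -> T) : 'rV[R]_k :=
  \row_i C v (x i).

(* R^k with its Borel sigma-algebra. *)
Notation borel_rV R k := (g_sigma_algebraType (@open 'rV[R]_k)).

Section measurable_row.
Context (R : realType) (k : nat) d (T : measurableType d).

Let box (c : 'rV[rat]_k) (q : nat) : set 'rV[R]_k :=
  [set u | forall j, `|u 0 j - ratr (c 0 j)| < q.+1%:R^-1].

Let boxE (u : 'rV[R]_k) q : exists2 c, box c q u &
  forall v, box c q v -> forall j, `|u 0 j - v 0 j| < q.+1%:R^-1 + q.+1%:R^-1.
Proof.
have /choice[c cP] (j : 'I_k) : exists r : rat, `|u 0 j - ratr r| < q.+1%:R^-1.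
  have /rat_in_itvoo[r] : u 0 j - q.+1%:R^-1 < u 0 j + q.+1%:R^-1 :> R.
    by rewrite ltrD2l gtrN// invr_gt0.
  by rewrite in_itv/= => /andP[r1 r2]; exists r; rewrite ltr_distlC r1 r2.
exists (\row_j c j) => [j|v vc j]; first by rewrite mxE.
rewrite (le_lt_trans (ler_distD (ratr (c j)) _ _))// ltrD//.
by have := vc j; rewrite mxE distrC.
Qed.

Lemma measurable_row (f : T -> 'rV[R]_k) :
  (forall j, measurable_fun setT (fun t => f t 0 j)) ->
  measurable_fun setT (f : T -> borel_rV R k).
Proof.
move=> mf; apply: measurability => [//|_ [U oU <-]]; rewrite setTI.
pose F n := if unpickle n is Some (c, q) then
  [set t | box c q (f t) /\ box c q `<=` U] else set0.
have -> : f @^-1` U = \bigcup_n F n.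
  apply/seteqP; split=> [t /= Ut|t [n _]]; last first.
    by rewrite /F; case: (unpickle n) => [[c q] [? sU]|//]; exact: sU.
  have /nbhs_ballP[e /= e0 eU] : nbhs (f t) U by exact: open_nbhs_nbhs.
  have e20 : 0 < e / 2 by rewrite divr_gt0.
  have [q _ /(_ q (leqnn q)) /= qe] := near_infty_natSinv_lt (PosNum e20).
  have [c cft cf] := boxE (f t) q.
  exists (pickle (c, q)) => //; rewrite /F pickleK; split=> // v cv.
  apply: eU; split=> // i j; rewrite ord1.
  by apply: lt_le_trans (cf v cv j) _; rewrite [leRHS]splitr lerD// ltW.
apply: bigcupT_measurable => n; rewrite /F.
case: (unpickle n) => [[c q]|]; last exact: measurable0.
have [cU|cU] := pselect (box c q `<=` U); last first.
  by rewrite (_ : mkset _ = set0)//; apply/seteqP; split=> // t [].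
rewrite (_ : mkset _ = \bigcap_(j in [set` enum 'I_k])
    (fun t => f t 0 j) @^-1` `]ratr (c 0 j) - q.+1%:R^-1, ratr (c 0 j) + q.+1%:R^-1[).
  rewrite bigcap_seq; apply: bigsetI_measurable => j _.
  by rewrite -[X in measurable X]setTI; apply: mf => //; exact: measurable_itv.
apply/seteqP; split=> t /= => [[ft _] j _|ft]; rewrite /= ?in_itv/=.
  by rewrite -ltr_distl ft.
split=> // j; have /= := ft j; rewrite mem_enum in_itv/= -ltr_distl.
by apply.
Qed.
End measurable_row.

Definition tcons (R : realType) (k : nat) 
    (p : measurableTypeR R * k.-tuple (measurableTypeR R)) :
  k.+1.-tuple (measurableTypeR R) := [tuple of p.1 :: p.2].

Lemma measurable_tcons (R : realType) (k : nat) :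
  measurable_fun setT (@tcons R k).
Proof. exact: measurable_cons. Qed.

HB.instance Definition _ (R : realType) (k : nat) :=
  @isMeasurableFun.Build _ _ _ _ (@tcons R k) (@measurable_tcons R k).

(* The law of k independent standard normal variables. *)
Fixpoint std_normal (R : realType) (k : nat) :
    probability (k.-tuple (measurableTypeR R)) R :=
  match k return probability (k.-tuple (measurableTypeR R)) R with
  | 0 => \d_[tuple]
  | k'.+1 => distribution
      (normal_prob 0 1 \x std_normal R k')%E (@tcons R k')
  end.

(* The positive semidefinite square root of a positive semidefinite matrix. *)
Definition sqrtmx (R : realType) (k : nat) (A : 'M[R]_k) : 'M[R]_k :=
  xget 0 [set S : 'M[R]_k | psdmx S /\ S *m S = A].

Definition affine_row (R : realType) (k : nat) (m : 'rV[R]_k) (S : 'M[R]_k)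
  (z : k.-tuple (measurableTypeR R)) : borel_rV R k := m + (\row_i tnth z i) *m S.

Lemma measurable_affine_row (R : realType) (k : nat) (m : 'rV[R]_k)
  (S : 'M[R]_k) : measurable_fun setT (affine_row m S).
Proof.
apply: measurable_row => j.
rewrite (_ : (fun _ => _) = fun z => m 0 j + \sum_i tnth z i * S i j); last first.
  by apply/funext => z; rewrite !mxE; under eq_bigr do rewrite mxE.
apply: measurable_funD => //; apply: measurable_sum => i.
by apply: measurable_funM => //; exact: measurable_tnth.
Qed.

HB.instance Definition _ (R : realType) (k : nat) (m : 'rV[R]_k)
    (S : 'M[R]_k) :=
  @isMeasurableFun.Build _ _ _ _ (affine_row m S) (measurable_affine_row m S).

(* The normal law N(m, Sigma), possibly degenerate: the law of m + Z S, where
   Z is a row of independent standard normal variables and S the positive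
   semidefinite square root of Sigma. *)
Definition mvnormal (R : realType) (k : nat) (m : 'rV[R]_k) (Sigma : 'M[R]_k) :
    probability (borel_rV R k) R :=
  distribution (std_normal R k) (affine_row m (sqrtmx Sigma)).

(* Every finite-dimensional marginal of X is normal. *)
Definition gaussian_process (R : realType) dO (Omega : measurableType dO)
    (P : probability Omega R) (I : Type) (X : I -> Omega -> R)
    (m : I -> R) (C : I -> I -> R) : Prop :=
  (forall i, measurable_fun setT (X i)) /\
  forall k (s : 'I_k -> I) (A : set (borel_rV R k)), measurable A ->
    pushforward P (fun w => \row_i X (s i) w : borel_rV R k) A =
    mvnormal (\row_i m (s i)) (gram C s) A.

(* A process valued in R^d, viewed as a scalar process indexed by points and
   output coordinates. The real kernel K acts identically and independently on
   the coordinates: the covariance of coordinates c and c' is K if c = c' and 0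
   otherwise. *)
Definition vector_gaussian_process (R : realType) dO
    (Omega : measurableType dO) (P : probability Omega R) (T : Type) (d : nat)
    (X : T -> Omega -> 'rV[R]_d) (mu : T -> 'rV[R]_d) (K : T -> T -> R) : Prop :=
  gaussian_process P (fun (vc : T * 'I_d) w => X vc.1 w 0 vc.2)
    (fun vc => mu vc.1 0 vc.2)
    (fun vc vc' => if vc.2 == vc'.2 then K vc.1 vc'.1 else 0).

(* Network outputs f t v under gradient flow from time 0 on; the right-hand
   derivative at t = 0 is not required to exist, only continuity. *)
Definition gradient_flow (R : realType) (T : Type) (d N : nat) (eta : R)
    (Theta : T -> T -> R) (x : 'I_N -> T) (Y : 'M[R]_(N, d))
    (f : R -> T -> 'rV[R]_d) : Prop :=
  forall v, f t v @[t --> 0^'+] --> f 0 v /\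
    forall t : R, 0 < t -> is_derive (t : R^o) 1 (f^~ v)
      (- eta *: (kernel_row Theta v x *m (\matrix_i f t (x i) - Y))).

Definition trained (R : realType) (T : Type) (d : nat)
    (f : R -> T -> 'rV[R]_d) (v : T) : 'rV[R]_d :=
  lim (f t v @[t --> +oo]).

Definition nbhd (R : realType) (k : nat) (e : R) (A : set 'rV[R]_k) :
    set 'rV[R]_k :=
  [set u | exists2 a, A a & l2norm (u - a) < e].

Definition levy_prokhorov (R : realType) (k : nat)
    (P Q : set (borel_rV R k) -> \bar R) : \bar R :=
  ereal_inf [set e%:E | e in [set e : R | 0 < e /\
    forall A : set (borel_rV R k), measurable A ->
      (P A <= Q (nbhd e A) + e%:E /\ Q A <= P (nbhd e A) + e%:E)%E]].

(* Main.v *)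
(* With G the training Gram matrix, f_t(v) - Theta(v, V) G^-1 f_t(V) is conserved
   by the gradient flow, and positive definiteness of G forces f_t(V) --> Y.
   Hence R_oo(v) = R_0(v) + Theta(v, V) G^-1 (Y - R_0(V)), where R_0(v) has
   exactly the prior law and the correction is at most |Theta(v, V)| Z with Z a
   finite random variable that does not depend on v. As |Theta(v, V)| --> 0, the
   correction tends to 0 in probability, which
   bounds the Levy-Prokhorov distance. *)
Require Import Defs.
From mathcomp Require Import all_boot all_order all_algebra.
From mathcomp Require Import all_classical all_reals all_analysis.
From mathcomp Require Import measurable_realfun ring lra.

Set Implicit Arguments.
Unset Strict Implicit.
Unset Printing Implicit Defensive.

Import Order.TTheory GRing.Theory Num.Theory.
Import numFieldTopology.Exports numFieldNormedType.Exports.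

Local Open Scope classical_set_scope.
Local Open Scope ring_scope.

(** * Quadratic forms and coercivity of positive definite matrices *)

Lemma sum_sqr_mulr_le (R : realType) (k : nat) (u : 'rV[R]_k) (i j : 'I_k) :
  `|u 0 i| * `|u 0 j| <= \sum_l u 0 l ^+ 2.
Proof.
have h l : `|u 0 l| ^+ 2 <= \sum_l u 0 l ^+ 2.
  rewrite real_normK ?num_real// (bigD1 l)//= lerDl sumr_ge0// => m _.
  exact: sqr_ge0.
have := h i; have := h j; have := sqr_ge0 (`|u 0 i| - `|u 0 j|); nra.
Qed.

Lemma quad_formE (R : realType) (k : nat) (A : 'M[R]_k) (u : 'rV[R]_k) :
  (u *m A *m u^T) 0 0 = \sum_i \sum_j u 0 i * (A i j * u 0 j).
Proof.
rewrite -mulmxA mxE; apply: eq_bigr => i _.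
by rewrite mxE mulr_sumr; apply: eq_bigr => j _; rewrite mxE.
Qed.

Lemma quad_form_le (R : realType) (k : nat) (A : 'M[R]_k) (u : 'rV[R]_k) :
  (u *m A *m u^T) 0 0 <= (\sum_i \sum_j `|A i j|) * \sum_i u 0 i ^+ 2.
Proof.
rewrite quad_formE mulr_suml; apply: ler_sum => i _.
rewrite mulr_suml; apply: ler_sum => j _.
rewrite mulrCA (le_trans (ler_norm _))// !normrM ler_wpM2l//.
exact: sum_sqr_mulr_le.
Qed.

(** A nonzero row [u] with [u *m A = 0] would make the quadratic form vanish at [u]. *)
Lemma pdmx_unit (R : realType) (k : nat) (A : 'M[R]_k) : pdmx A -> A \in unitmx.
Proof.
move=> [_ Apos]; rewrite -row_free_unit -kermx_eq0; apply/eqP/row_matrixP => i.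
rewrite row0; apply/eqP/negPn/negP => /Apos.
by rewrite -row_mul mulmx_ker row0 mul0mx mxE ltxx.
Qed.

(** Coercivity without eigenvalues or compactness: an upper bound [C] for the form of [invmx A]
    yields the lower bound [C^-1] for the form of [A]. *)
Lemma pdmx_coercive (R : realType) (k : nat) (A : 'M[R]_k) : pdmx A ->
  exists2 c, 0 < c & forall u : 'rV[R]_k,
    c * \sum_i u 0 i ^+ 2 <= \sum_i \sum_j u 0 i * (A i j * u 0 j).
Proof.
move=> Apd; have Aunit := pdmx_unit Apd; have [Asym Apos] := Apd.
(* The summand 1 keeps [C] positive even when [k = 0] and the sum is empty. *)
pose C : R := 1 + \sum_i \sum_j `|invmx A i j|.
have C0 : 0 < C.
  by rewrite ltr_pwDl// sumr_ge0// => i _; rewrite sumr_ge0.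
exists C^-1 => [|u]; first by rewrite invr_gt0.
rewrite -quad_formE; set n := \sum_i _; set q : R := (_ *m _) 0 0.
have n0 : 0 <= n by rewrite sumr_ge0// => i _; exact: sqr_ge0.
pose w := u *m invmx A.
have wA : w *m A = u by rewrite mulmxKV.
have Aw : A *m w^T = u^T by rewrite -[A in LHS]Asym -trmx_mul wA.
(* Nonnegativity of the form at [u - C^-1 w], which needs [w A w^T <= C |u|^2]. *)
have : 0 <= ((u - C^-1 *: w) *m A *m (u - C^-1 *: w)^T) 0 0.
  have [->|/Apos/ltW//] := eqVneq (u - C^-1 *: w) 0.
  by rewrite !mul0mx mxE.
have uu : (u *m u^T) 0 0 = n.
  by rewrite mxE; apply: eq_bigr => i _; rewrite mxE expr2.
have wu : (w *m u^T) 0 0 <= C * n.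
  by rewrite (le_trans (quad_form_le _ _))// ler_wpM2r// lerDr.
have -> : (u - C^-1 *: w)^T = u^T - C^-1 *: w^T by rewrite linearB linearZ.
rewrite !mulmxBl !mulmxBr -!scalemxAl -!scalemxAr wA.
rewrite -[u *m A *m w^T]mulmxA Aw.
have -> : u *m w^T = w *m u^T by rewrite -{1}wA -mulmxA Aw.
set b : R := (w *m u^T) 0 0 in wu *.
have -> : (u *m A *m u^T - C^-1 *: (u *m u^T)
    - (C^-1 *: (u *m u^T) - C^-1 *: (C^-1 *: (w *m u^T)))) 0 0
  = q - C^-1 * n - (C^-1 * n - C^-1 * (C^-1 * b)).
  rewrite -uu /q /b; move: (u *m A *m u^T) (u *m u^T) (w *m u^T) => B1 B2 B3.
  by rewrite !mxE.
(* The form expands to [q - 2 n / C + b / C^2], which is nonnegative; with [b <= C n] this leaves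
   [q >= n / C]. *)
have : C^-1 * (C^-1 * b) <= C^-1 * n.
  by rewrite ler_pM2l ?invr_gt0// ler_pdivrMl.
lra.
Qed.

(** * Gradient flow: decay of the residual and the trained network in closed form *)

Lemma is_derive_coord (R : realType) (m n : nat) (M : R -> 'M[R]_(m, n))
    (t : R) (dM : 'M[R]_(m, n)) i j :
  is_derive (t : R^o) 1 M dM -> is_derive t 1 (fun s => M s i j) (dM i j).
Proof.
move=> [Mt dMt]; split; first by have /derivable_mxP := Mt; exact.
by move/(congr1 (fun B : 'M[R]_(m, n) => B i j)): dMt; rewrite derive_mx// mxE.
Qed.

Lemma cvg_coord (R : realType) (m n : nat) (S : Type) (F : set_system S)
    {FF : Filter F} (M : S -> 'M[R]_(m, n)) (L : 'M[R]_(m, n)) :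
  (forall i j, M s i j @[s --> F] --> L i j) -> M s @[s --> F] --> L.
Proof.
move=> ML; apply/cvgrPdist_le => e e0; near=> s.
rewrite /Num.Def.normr/= mx_normrE (bigmax_le _ (ltW e0))//= => ij _.
rewrite !mxE; move: ij; near: s; apply: filter_forall => ij.
by have /cvgrPdist_le := ML ij.1 ij.2; exact.
Unshelve. all: by end_near. Qed.

(** The squared Frobenius norm [V] of [E] is a Lyapunov function: coercivity of [A] gives
    [V' <= - 2 eta l V]. A decay of order [1 / t] is enough for the limit, so no exponential bound
    is derived. *)
Lemma pd_linear_flow_cvg0 (R : realType) (N d : nat) (A : 'M[R]_N) (eta : R)
    (E : R -> 'M[R]_(N, d)) : pdmx A -> 0 < eta ->
  (forall t : R, 0 < t -> forall i c, is_derive t 1 (fun s => E s i c)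
     (- eta * \sum_j A i j * E t j c)) ->
  forall i c, E t i c @[t --> +oo] --> (0 : R).
Proof.
move=> /pdmx_coercive[l l0 Al] eta0 dE.
pose V t : R := \sum_c \sum_i E t i c ^+ 2.
pose dV t : R := \sum_c \sum_i
  (E t i c * (- eta * \sum_j A i j * E t j c) *+ 2).
have V0 t : 0 <= V t.
  by apply: sumr_ge0 => c _; apply: sumr_ge0 => i _; exact: sqr_ge0.
have EV t i c : E t i c ^+ 2 <= V t.
  rewrite /V (bigD1 c)//= (bigD1 i)//= -addrA lerDl addr_ge0//.
    by apply: sumr_ge0 => j _; exact: sqr_ge0.
  by apply: sumr_ge0 => c' _; apply: sumr_ge0 => j _; exact: sqr_ge0.
have derV (t : R) : 0 < t -> is_derive t 1 V (dV t).
  move=> t0.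
  have -> : V = \sum_c \sum_i (fun s => E s i c ^+ 2).
    apply/funext => s; rewrite /V fct_sumE; apply: eq_bigr => c _.
    by rewrite fct_sumE.
  apply: is_derive_sum => c; apply: is_derive_sum => i.
  have := dE t t0 i c => dEi.
  apply: is_derive_eq.
  by rewrite mulr2n.
have dVle t : dV t <= - (2 * eta * l) * V t.
  rewrite /dV /V mulr_sumr; apply: ler_sum => c _.
  set S := \sum_i E t i c ^+ 2.
  pose Q : R := \sum_i \sum_j E t i c * (A i j * E t j c).
  have lSQ : l * S <= Q.
    have := Al (\row_i E t i c); under eq_bigr do rewrite mxE.
    by under [X in _ <= X -> _]eq_bigr do under eq_bigr do rewrite !mxE.
  have -> : \sum_i E t i c * (- eta * \sum_j A i j * E t j c) *+ 2 =
      - (2 * eta) * Q.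
    rewrite /Q mulr_sumr; apply: eq_bigr => i _.
    by rewrite -mulr_sumr -mulr_natl; ring.
  have : 0 <= eta * (Q - l * S) by rewrite mulr_ge0 ?subr_ge0// ltW.
  lra.
pose b := 2 * eta * l; have b0 : 0 < b by rewrite !mulr_gt0.
(* Since [V' <= - b V], the function [t V t] is nonincreasing past [b^-1]. *)
pose W t := t * V t.
have derW (t : R) : 0 < t -> is_derive t 1 W (t * dV t + V t).
  move=> t0; have := derV t t0 => dVt.
  have -> : W = id * V by [].
  apply: is_derive_eq.
  by rewrite /= /GRing.scale/= mulr1.
have Wle t : b^-1 <= t -> W t <= W b^-1.
  have bV0 : 0 < b^-1 by rewrite invr_gt0.
  have pos s : s \in `]b^-1, +oo[%R -> 0 < s.
    by rewrite in_itv/= andbT => /(lt_trans bV0).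
  apply: (ler0_derive1_nincry (a := b^-1)) => //.
  - by move=> s /pos s0; have [] := derW s s0.
  - move=> s sb; rewrite derive1E; have [_ ->] := derW s (pos s sb).
    (* The derivative [s V' + V] is at most [(1 - s b) V], which is nonpositive since [s b >= 1]. *)
    have := dVle s; rewrite -/b => dVs.
    have sb1 : 1 <= s * b.
      by rewrite -ler_pdivrMr// div1r ltW//; move: sb; rewrite in_itv/= andbT.
    have := V0 s; have := pos s sb; nra.
  - apply: continuous_in_subspaceT => s /[!inE]/=; rewrite in_itv/= andbT => bs.
    have s0 : 0 < s by exact: lt_le_trans bs.
    by have [/derivable1_diffP/differentiable_continuous] := derW s s0.
move=> i c; apply/cvgrPdist_le => e e0; near=> t.
rewrite sub0r normrN.
suff : `|E t i c| ^+ 2 <= e ^+ 2 by rewrite ler_pXn2r// nnegrE ltW.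
rewrite real_normK ?num_real// (le_trans (EV _ _ _))//.
have t0 : 0 < t by near: t; exact: nbhs_pinfty_gt.
have tb : b^-1 <= t by near: t; apply: nbhs_pinfty_ge; exact: num_real.
(* Multiplied by [t], the goal [V t <= e ^+ 2] follows from [W t <= W b^-1], as soon as
   [t >= W b^-1 / e ^+ 2]. *)
rewrite -(ler_pM2l t0) -/(W t) (le_trans (Wle t tb))//.
rewrite -ler_pdivrMr ?exprn_gt0//.
Unshelve. all: by end_near. Qed.

(** A deterministic statement about one trajectory, to be applied separately to each outcome [w]:
    randomness enters only through the initial values [f 0]. *)
Lemma gradient_flow_trained (R : realType) (T : Type) (d N : nat) (eta : R)
    (Theta : T -> T -> R) (x : 'I_N -> T) (Y : 'M[R]_(N, d))
    (f : R -> T -> 'rV[R]_d) (v : T) :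
  pdmx (gram Theta x) -> 0 < eta -> gradient_flow eta Theta x Y f ->
  trained f v = f 0 v + kernel_row Theta v x *m
    (invmx (gram Theta x) *m (Y - \matrix_i f 0 (x i))).
Proof.
move=> Gpd eta0 gf; set G := gram Theta x in Gpd *.
have Gunit := pdmx_unit Gpd.
pose h t : 'M[R]_(N, d) := \matrix_i f t (x i).
have hE t i c : h t i c = f t (x i) 0 c by rewrite mxE.
have df u (t : R) c : 0 < t -> is_derive t 1 (fun s => f s u 0 c)
    (- eta * \sum_j Theta u (x j) * (h t - Y) j c).
  move=> t0; have := is_derive_coord 0 c ((gf u).2 t t0).
  rewrite !mxE; under eq_bigr do rewrite mxE; exact.
have f0 u c : f t u 0 c @[t --> 0^'+] --> f 0 u 0 c.
  exact: (cvg_comp _ _ (gf u).1 (@coord_continuous _ _ _ 0 c (f 0 u))).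
(* The residual [h t - Y] on the training set solves the closed linear system with matrix
   [- eta G]. *)
have hcvg i c : h t i c @[t --> +oo] --> Y i c.
  have : (h t - Y) i c @[t --> +oo] --> (0 : R).
    apply: (pd_linear_flow_cvg0 (E := fun t => h t - Y) Gpd eta0) => t t0 {}i {}c.
    have -> : (fun s => (h s - Y) i c) =
        (fun s => f s (x i) 0 c) - cst (Y i c).
      by apply/funext => s; rewrite !mxE.
    have := df (x i) t c t0 => dfi.
    apply: is_derive_eq.
    by rewrite subr0; congr (_ * _); apply: eq_bigr => j _; rewrite [G _ _]mxE.
  move=> hY; rewrite -[Y i c]add0r.
  under eq_fun do rewrite -[h _ i c](subrK (Y i c)).
  apply: cvgD; last exact: cvg_cst.
  by move: hY; under eq_fun do rewrite !mxE -hE.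
pose k := kernel_row Theta v x *m invmx G.
have kG : k *m G = kernel_row Theta v x by rewrite mulmxKV.
(* [f t v - k h(t)] is a conserved quantity of the flow. *)
pose g c t := f t v 0 c - \sum_i k 0 i * h t i c.
have dg c (t : R) : 0 < t -> is_derive t 1 (g c) 0.
  move=> t0.
  have -> : g c = (fun s => f s v 0 c)
      - \sum_i (fun s => k 0 i *: f s (x i) 0 c).
    apply/funext => s; rewrite /g !fctE fct_sumE.
    by congr (_ - _); apply: eq_bigr => i _; rewrite hE.
  have := df v t c t0 => dv.
  have dx i := df (x i) t c t0.
  apply: is_derive_eq.
  apply/eqP; rewrite subr_eq0; apply/eqP.
  (* The choice of [k] makes the two drifts agree: [k G] is the kernel row at [v]. *)
  transitivity (- eta * ((k *m G) *m (h t - Y)) 0 c).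
    by rewrite kG mxE; congr (_ * _); apply: eq_bigr => j _; rewrite [in RHS]mxE.
  rewrite -mulmxA mxE mulr_sumr; apply: eq_bigr => i _.
  rewrite /GRing.scale/= mulrCA; congr (_ * (_ * _)).
  by rewrite mxE; apply: eq_bigr => j _; rewrite [G _ _]mxE.
(* Mean value theorem on [[0, t]]: the derivative is used only in the interior, and at 0 the
   right-continuity contained in [gradient_flow] suffices. *)
have gcst c t : 0 < t -> g c t = g c 0.
  move=> t0; apply/eqP; rewrite -subr_eq0.
  have [||s _ ->] := @MVT_segment R (g c) (cst 0) 0 t (ltW t0).
  - by move=> s; rewrite in_itv/= => /andP[s0 _]; exact: dg.
  - apply/continuous_within_itvP => //; split.
    + move=> s; rewrite in_itv/= => /andP[s0 _].
      by have [/derivable1_diffP/differentiable_continuous] := dg c s s0.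
    + apply: cvgB; first exact: f0.
      apply: cvg_big => [|i _]; first exact: add_continuous.
      apply: cvgMl_tmp.
      by rewrite hE; under eq_fun do rewrite hE; exact: f0.
    + apply: cvg_at_left_filter.
      by have [/derivable1_diffP/differentiable_continuous] := dg c t t0.
  - by rewrite mul0r.
apply: cvg_lim => //; apply: cvg_coord => i c; rewrite ord1 {i}.
rewrite mulmxA -/k.
have -> : (f 0 v + k *m (Y - h 0)) 0 c = g c 0 + \sum_i k 0 i * Y i c.
  by rewrite /g mulmxBr !mxE addrA addrAC.
(* For [t > 0], conservation expresses [f t v] through [h t], whose limit [Y] is known. *)
apply: (@cvg_trans _ (g c 0 + \sum_i k 0 i * h t i c @[t --> +oo])).
  apply: near_eq_cvg; near=> t.
  by rewrite -(gcst c t) /g ?subrK//; near: t; exact: nbhs_pinfty_gt.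
apply: cvgD; first exact: cvg_cst.
apply: cvg_big => [|i _]; first exact: add_continuous.
by apply: cvgMl_tmp; exact: hcvg.
Unshelve. all: by end_near. Qed.

(** * The Euclidean norm *)

Lemma l2norm_continuous (R : realType) (k : nat) : continuous (@l2norm R k).
Proof.
have sum_continuous (T : topologicalType) (F : 'I_k -> T -> R) :
    (forall i, continuous (F i)) -> continuous (fun t => \sum_i F i t).
  move=> cF t; apply: cvg_big => [|i _]; first exact: add_continuous.
  exact: cF.
move=> u; apply: (continuous_comp (f := fun u : 'rV[R]_k => \sum_i u 0 i ^+ 2)).
  apply: sum_continuous => i {}u.
  apply: (@continuous_comp _ _ _ (fun u : 'rV[R]_k => u 0 i) (fun r => r ^+ 2)).
    exact: coord_continuous.
  exact: exprn_continuous.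
exact: sqrt_continuous.
Qed.

Lemma l2normN (R : realType) (k : nat) (u : 'rV[R]_k) : l2norm (- u) = l2norm u.
Proof.
by congr Num.sqrt; apply: eq_bigr => i _; rewrite mxE sqrrN.
Qed.

Lemma l2norm_le_sum (R : realType) (k : nat) (u : 'rV[R]_k) :
  l2norm u <= \sum_i `|u 0 i|.
Proof.
have S0 : 0 <= \sum_i `|u 0 i| by exact: sumr_ge0.
rewrite -[leRHS]ger0_norm// -sqrtr_sqr ler_wsqrtr// expr2 mulr_suml.
apply: ler_sum => i _; rewrite -real_normK ?num_real// expr2 ler_wpM2l//.
by rewrite (bigD1 i)//= lerDl sumr_ge0.
Qed.

Lemma coord_le_l2norm (R : realType) (k : nat) (u : 'rV[R]_k) i :
  `|u 0 i| <= l2norm u.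
Proof.
rewrite -sqrtr_sqr ler_wsqrtr// (bigD1 i)//= lerDl.
by apply: sumr_ge0 => j _; exact: sqr_ge0.
Qed.

Lemma l2norm_mulmx_le (R : realType) (N d : nat) (u : 'rV[R]_N)
    (B : 'M[R]_(N, d)) :
  l2norm (u *m B) <= l2norm u * \sum_j \sum_i `|B i j|.
Proof.
rewrite (le_trans (l2norm_le_sum _))// mulr_sumr ler_sum// => j _.
rewrite mxE (le_trans (ler_norm_sum _ _ _))// mulr_sumr ler_sum// => i _.
by rewrite normrM ler_wpM2r// coord_le_l2norm.
Qed.

(** * Lévy-Prokhorov distance by coupling, and tightness *)

Lemma open_nbhd (R : realType) (k : nat) (e : R) (A : set 'rV[R]_k) :
  open (nbhd e A).
Proof.
have -> : nbhd e A = \bigcup_(a in A) (fun u => l2norm (u - a)) @^-1` [set r | r < e].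
  by apply/seteqP; split=> u /= [a Aa ua]; exists a.
apply: bigcup_open => a _; apply: open_comp; last exact: open_lt.
move=> u _; apply: (continuous_comp (f := fun u : 'rV[R]_k => u - a)).
  by apply: (@cvgB _ _ _ (nbhs u)); [exact: cvg_id|exact: cvg_cst].
exact: l2norm_continuous.
Qed.

Lemma measurable_nbhd (R : realType) (k : nat) (e : R) (A : set 'rV[R]_k) :
  measurable (nbhd e A : set (borel_rV R k)).
Proof. by apply: sub_sigma_algebra; exact: open_nbhd. Qed.

Lemma levy_prokhorov_ge0 (R : realType) (k : nat)
    (P Q : set (borel_rV R k) -> \bar R) : (0 <= levy_prokhorov P Q)%E.
Proof. by apply: le_ereal_inf_tmp => _ [e [e0 _] <-]; rewrite lee_fin ltW. Qed.

(** Coupling bound: off [B], if [X] lies in [A] then [X'] lies in the [e]-neighbourhood of [A], and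
    conversely. The same [e] serves as radius and as bound on the exceptional mass. *)
Lemma levy_prokhorov_close_le (R : realType) (k : nat) dO
    (Omega : measurableType dO) (P : probability Omega R)
    (X X' : Omega -> borel_rV R k) (Q : set (borel_rV R k) -> \bar R)
    (B : set Omega) (e : R) :
  measurable_fun setT X -> measurable_fun setT X' ->
  (forall A, measurable A -> pushforward P X' A = Q A) ->
  0 < e -> measurable B -> (P B <= e%:E)%E ->
  (forall w, ~ B w -> l2norm (X w - X' w : 'rV[R]_k) < e) ->
  (levy_prokhorov (pushforward P X) Q <= e%:E)%E.
Proof.
move=> mX mX' X'Q e0 mB PB XX'; apply: ereal_inf_lbound; exists e => //.
split=> // A mA.
have mp (Y : Omega -> borel_rV R k) C : measurable_fun setT Y ->
    measurable C -> measurable (Y @^-1` C).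
  by move=> mY mC; rewrite -[X in measurable X]setTI; exact: mY.
(* Stated for an arbitrary pair, since it is used once in each direction. *)
have main (Y Y' : Omega -> borel_rV R k) : measurable_fun setT Y ->
    measurable_fun setT Y' ->
    (forall w, ~ B w -> l2norm (Y w - Y' w : 'rV[R]_k) < e) ->
    (pushforward P Y A <= pushforward P Y' (nbhd e A) + e%:E)%E.
  move=> mY mY' YY'; have mN := measurable_nbhd e A.
  rewrite /pushforward.
  apply: (@le_trans _ _ (P (Y' @^-1` nbhd e A `|` B))).
    apply: le_measure; rewrite ?inE; [exact: mp|apply: measurableU => //; exact: mp|].
    move=> w /= YA; have [Bw|nBw] := pselect (B w); first by right.
    by left; exists (Y w) => //; rewrite -l2normN opprB; exact: YY'.
  apply: le_trans (measureU2 _ _ _) _ => //; first exact: mp.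
  by rewrite leeD.
rewrite -!X'Q//; last exact: measurable_nbhd.
split; first exact: main.
by apply: main => // w /XX'; rewrite -l2normN opprB.
Qed.

(** Continuity from above: the events [n.+1 <= Z] decrease to the empty set because [Z] takes finite
    values. The successor makes the threshold positive. *)
Lemma measurable_fun_tight (R : realType) dO (Omega : measurableType dO)
    (P : probability Omega R) (Z : Omega -> R) (e : R) :
  measurable_fun setT Z -> 0 < e ->
  exists2 M : R, 0 < M & measurable [set w | M <= Z w] /\
    (P [set w | (M <= Z w)%R] <= e%:E)%E.
Proof.
move=> mZ e0.
have mF M : measurable [set w | M <= Z w].
  by rewrite -[X in measurable X]setTI -[X in _ `&` X]preimage_itvcy;
    apply: mZ => //; exact: measurable_itv.
pose F (n : nat) := [set w | n.+1%:R <= Z w].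
have F0 : \bigcap_n F n = set0.
  apply/seteqP; split=> // w /(_ (Num.truncn (Z w)) I) /=.
  by rewrite /F/= leNgt truncnS_gt.
have : P \o F @ \oo --> P (\bigcap_n F n).
  apply: nonincreasing_cvg_mu => //.
  - by rewrite -ge0_fin_numE//; apply: fin_num_measure; exact: mF.
  - by move=> i; exact: mF.
  - by rewrite F0; exact: measurable0.
  - move=> m n mn; apply/subsetPset => w; rewrite /F/=.
    by apply: le_trans; rewrite ler_nat.
rewrite F0 measure0 => /fine_cvgP[_ /cvgrPdist_le/(_ _ e0)].
move=> [n _ /(_ n (leqnn n))]; rewrite /= sub0r normrN ger0_norm ?fine_ge0// => PF.
exists n.+1%:R; first by rewrite ltr0n.
split=> //; rewrite -[leLHS]fineK ?lee_fin//; exact: fin_num_measure.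
Qed.

(** * Convergence of the predictive law to the prior *)

Lemma far_from_filter (R : realType) (n : nat) (S : set 'rV[R]_n) :
  Filter (far_from S).
Proof.
apply: filter_from_filter; first by exists 0.
move=> M M' _ _; exists (Num.max M M') => // v /= Mv; split=> /=;
  apply: le_lt_trans Mv; by rewrite lee_fin le_max lexx ?orbT.
Qed.

Theorem lemma3p2 (R : realType) (n d N : nat)
    (dO : measure_display) (Omega : measurableType dO) (P : probability Omega R)
    (mu : 'rV[R]_n -> 'rV[R]_d) (K Theta : 'rV[R]_n -> 'rV[R]_n -> R)
    (x : 'I_N -> 'rV[R]_n) (Y : 'M[R]_(N, d)) (eta : R)
    (net : R -> 'rV[R]_n -> Omega -> 'rV[R]_d) :
  measurable_fun setT (mu : borel_rV R n -> borel_rV R d) ->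
  psd_kernel K ->
  psd_kernel Theta ->
  injective x ->
  pdmx (gram Theta x) ->
  0 < eta ->
  vector_gaussian_process P (net 0) mu K ->
  (forall w, gradient_flow eta Theta x Y (fun t v => net t v w)) ->
  l2norm (kernel_row Theta v x) @[v --> far_from (range x)] --> (0 : R) ->
  levy_prokhorov
    (pushforward P
      (fun w => trained (fun t u => net t u w) v : borel_rV R d))
    (mvnormal (mu v) (K v v)%:M) @[v --> far_from (range x)] --> 0%E.
Proof.
move=> _ _ _ _ Gpd eta0 [mnet netP] gf kcvg.
have FF := far_from_filter (range x).
have mnet0 v c : measurable_fun setT (fun w => net 0 v w 0 c) := mnet (v, c).
have net0P v A : measurable A ->
    pushforward P (fun w => net 0 v w : borel_rV R d) A =
    mvnormal (mu v) (K v v)%:M A.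
  (* The process is evaluated at the [d] output coordinates of the single point [v]; independence
     across coordinates makes the covariance scalar. *)
  move=> mA; have := netP d (fun c => (v, c)) A mA.
  have -> : (fun w => \row_i net 0 v w 0 i : borel_rV R d) = net 0 v.
    by apply/funext => w; apply/rowP => i; rewrite mxE.
  have -> : \row_i mu v 0 i = mu v by apply/rowP => i; rewrite mxE.
  suff -> : gram (fun vc vc' : 'rV[R]_n * 'I_d =>
      if vc.2 == vc'.2 then K vc.1 vc'.1 else 0) (fun c => (v, c)) = (K v v)%:M.
    by [].
  by apply/matrixP => i j; rewrite !mxE /=; case: eqP.
pose G := gram Theta x.
pose B w : 'M[R]_(N, d) := invmx G *m (Y - \matrix_i net 0 (x i) w).
have trainedE v w : trained (fun t u => net t u w) v =
    net 0 v w + kernel_row Theta v x *m B w.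
  exact: gradient_flow_trained Gpd eta0 (gf w).
have mB i c : measurable_fun setT (fun w => B w i c).
  under eq_fun do rewrite mxE.
  apply: measurable_sum => j; under eq_fun do rewrite !mxE.
  by apply: measurable_funM => //; apply: measurable_funB.
(* [Z] bounds the correction up to the factor [l2norm (kernel_row Theta v x)] and does not involve
   [v], so the threshold [M] below can be fixed before [v]. *)
pose Z w := \sum_c \sum_i `|B w i c|.
have mZ : measurable_fun setT Z.
  apply: measurable_sum => c; apply: measurable_sum => i.
  exact: measurableT_comp.
have Z0 w : 0 <= Z w by apply: sumr_ge0 => c _; exact: sumr_ge0.
have LPle e : 0 < e -> \forall v \near far_from (range x), (levy_prokhorov
    (pushforward P
      (fun w => trained (fun t u => net t u w) v : borel_rV R d))
    (mvnormal (mu v) (K v v)%:M) <= e%:E)%E.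
  move=> e0; have [M M0 [mM PM]] := measurable_fun_tight P mZ e0.
  have eM0 : 0 < e / M by rewrite divr_gt0.
  near=> v.
  have kv : l2norm (kernel_row Theta v x) < e / M.
    rewrite (le_lt_trans (ler_norm _))// -normrN -sub0r; near: v.
    by have /cvgrPdist_lt := kcvg; exact.
  (* The trained network is coupled with its own initialization; outside [M <= Z] the correction is
     smaller than [(e / M) * M = e]. *)
  apply: (levy_prokhorov_close_le (X' := net 0 v) (B := [set w | M <= Z w])) => //.
  - apply: measurable_row => c; under eq_fun do rewrite trainedE !mxE.
    apply: measurable_funD => //; apply: measurable_sum => i.
    exact: measurable_funM.
  - exact: measurable_row.
  - exact: net0P.
  - move=> w /= /negP; rewrite -ltNge => ZM.
    rewrite trainedE addrAC subrr add0r (le_lt_trans (l2norm_mulmx_le _ _))//.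
    rewrite -/(Z w) (@le_lt_trans _ _ (l2norm (kernel_row Theta v x) * M))//.
      by rewrite ler_wpM2l ?sqrtr_ge0// ltW.
    by rewrite -ltr_pdivlMr.
have LPfin P' Q e : (levy_prokhorov P' Q <= e%:E)%E ->
    @levy_prokhorov R d P' Q \is a fin_num.
  by move=> LPe; rewrite ge0_fin_numE ?levy_prokhorov_ge0// (le_lt_trans LPe)// ltry.
(* Convergence in the extended reals: the distance is eventually finite, by the bound with [e = 1],
   and its real values tend to 0. *)
apply/fine_cvgP; split.
  by apply: filterS (LPle 1 ltr01) => v; exact: LPfin.
apply/cvgrPdist_le => e e0; apply: filterS (LPle e e0) => v LPe /=.
rewrite sub0r normrN ger0_norm ?fine_ge0 ?levy_prokhorov_ge0//.
by rewrite -lee_fin fineK//; exact: LPfin LPe.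
Unshelve. all: by end_near. Qed.
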